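(* Let $(M,g)$ be a connected Einstein Lorentz manifold, and let $d_M^{[g]}$ be its conformal Kobayashi pseudodistance. (1) If $d_M^{[g]}$ is nontrivial, then $g$ has at least one incomplete null geodesic. (2) If $d_M^{[g]}$ is nondegenerate, then every null geodesic of $g$ is incomplete.
   Context: Let $n\ge 2$ denote the dimension of $M$. A Lorentz metric $g$ is Einstein if its Ricci tensor satisfies $Ric = c\,g$ for some constant $c$. A vector $X\neq 0$ is null if $g(X,X)=0$; a null geodesic is a geodesic with null velocity. An inextendible null geodesic is complete if its affine parametrization is defined on all of $\mathbb{R}$, and incomplete otherwise; statements about completeness of null geodesics refer to inextendible ones. Projective parameters: let $\gamma(s)$ be an affinely parametrized null geodesic of $g$. A projective parameter along $\gamma$ is a solution $p=p(s)$ of $$\{p,s\} = -\frac{2}{n-2}\,Ric\big(\gamma'(s),\gamma'(s)\big),\qquad \{p,s\}:=\frac{p'''}{p'}-\frac32\Big(\frac{p''}{p'}\Big)^2,$$ where primes denote derivatives with respect to $s$. It is well-defined up to linear fractional transformations. A projectively parametrized null geodesic is a null geodesic parametrized by a projective parameter. Let $I=(-1,1)\subset\mathbb{R}$ with the Poincaré metric $ds_I^2=\frac{4\,du^2}{(1-u^2)^2}$ and its distance function $$\rho_I(u_1,u_2)=\left|\log\frac{(1+u_1)(1-u_2)}{(1-u_1)(1+u_2)}\right|.$$ A Kobayashi path from $x$ to $y$ in $M$ consists of points $x=x_0,x_1,\dots,x_k=y$ of $M$, pairs of points $a_1,b_1,\dots,a_k,b_k\in I$, and projectively parametrized null geodesics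 $\gamma_1,\dots,\gamma_k: I\to M$ with $\gamma_i(a_i)=x_{i-1}$ and $\gamma_i(b_i)=x_i$ for $i=1,\dots,k$. The length of the path $\alpha=\{a_i,b_i,\gamma_i\}_{i=1}^k$ is $L(\alpha)=\sum_{i=1}^k\rho_I(a_i,b_i)$. The conformal Kobayashi pseudodistance is $$d_M^{[g]}(x,y)=\inf_\alpha L(\alpha),$$ the infimum being over all Kobayashi paths $\alpha$ from $x$ to $y$; here $[g]$ denotes the conformal class of $g$, on which alone $d_M^{[g]}$ depends. Any two points of a connected Lorentz manifold can be joined by a Kobayashi path. $d_M^{[g]}$ is nontrivial if it is not identically zero on $M\times M$, and nondegenerate if $d_M^{[g]}(x,y)=0$ implies $x=y$. *)

(* Defs.v *)
From HB Require Import structures.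
From mathcomp Require Import all_boot all_order all_algebra.
From mathcomp Require Import all_classical all_reals all_analysis.

Set Implicit Arguments.
Unset Strict Implicit.
Unset Printing Implicit Defensive.

Import Order.TTheory GRing.Theory Num.Theory.
Import numFieldNormedType.Exports.

Local Open Scope classical_set_scope.
Local Open Scope ring_scope.

Section Smooth.
Context {R : realType} {n : nat}.

Definition pd (i : 'I_n) (f : 'rV[R]_n -> R) (x : 'rV[R]_n) : R :=
  'D_(delta_mx 0 i) f x.

(* Meant for U open, so that all derivatives at points of U only depend on
   the restriction of f to U. *)
Fixpoint Ck_on (k : nat) (U : set 'rV[R]_n) (f : 'rV[R]_n -> R) : Prop :=
  {in U, continuous f} /\
  (if k is k'.+1 then
     forall i : 'I_n, (forall x, U x -> derivable f x (delta_mx 0 i)) /\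
                      Ck_on k' U (pd i f)
   else True).

Definition smooth_on (U : set 'rV[R]_n) (f : 'rV[R]_n -> R) : Prop :=
  forall k, Ck_on k U f.

End Smooth.

(* Charts are total functions; only [chart_map] on [chart_dom] and
   [chart_inv] on the image of [chart_dom] are meaningful. *)
Record chart (R : realType) (n : nat) (M : topologicalType) := Chart {
  chart_dom : set M;
  chart_map : M -> 'rV[R]_n;
  chart_inv : 'rV[R]_n -> M;
  chart_dom_open : open chart_dom;
  chart_img_open : open (chart_map @` chart_dom);
  chart_mapK : forall x, chart_dom x -> chart_inv (chart_map x) = x;
  chart_map_continuous : {in chart_dom, continuous chart_map};
  chart_inv_continuous :
    {in chart_map @` chart_dom, continuous chart_inv}
}.

Record manifold (R : realType) (n : nat) := Manifold {
  points :> topologicalType;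
  manifold_hausdorff : hausdorff_space points;
  manifold_second_countable : @second_countable points;
  chart_index : Type;
  atlas : chart_index -> chart R n points;
  atlas_cover : forall x : points, exists i, chart_dom (atlas i) x;
  atlas_smooth : forall (i j : chart_index) (k : 'I_n),
    smooth_on
      (chart_map (atlas i) @` (chart_dom (atlas i) `&` chart_dom (atlas j)))
      (fun x => chart_map (atlas j) (chart_inv (atlas i) x) 0 k)
}.

Section Charts.
Context {R : realType} {n : nat} (M : manifold R n).

Definition dom (i : chart_index M) : set M := chart_dom (atlas i).
Definition coord (i : chart_index M) : M -> 'rV[R]_n := chart_map (atlas i).
Definition img (i : chart_index M) : set 'rV[R]_n := coord i @` dom i.
Definition transition (i j : chart_index M) : 'rV[R]_n -> 'rV[R]_n :=
  coord j \o chart_inv (atlas i).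

End Charts.

(* A has signature (-, +, ..., +). *)
Definition lorentzian {R : realType} {n : nat} (A : 'M[R]_n) : Prop :=
  A^T = A /\
  exists2 P : 'M[R]_n, P \in unitmx &
    P *m A *m P^T = diag_mx (\row_j (-1) ^+ (j == 0%N :> nat)).

(* A Lorentz metric is given by its component matrices g_ij in the charts of
   the atlas.  With row vectors, the (i, k) entry of the Jacobian 'J tau x is
   the i-th partial derivative of the k-th component of tau, hence the form of
   the transformation law of a (0,2)-tensor. *)
Record lorentz_metric (R : realType) (n : nat) (M : manifold R n) :=
  LorentzMetric {
  metric_comp :> chart_index M -> 'rV[R]_n -> 'M[R]_n;
  metric_smooth : forall i (k l : 'I_n),
    smooth_on (img i) (fun x => metric_comp i x k l);
  metric_lorentzian : forall i x, img i x -> lorentzian (metric_comp i x);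
  metric_change : forall i j (p : M), dom i p -> dom j p ->
    metric_comp i (coord i p) =
      'J (transition i j) (coord i p) *m metric_comp j (coord j p)
        *m ('J (transition i j) (coord i p))^T
}.

Section Curvature.
Context {R : realType} {n : nat}.
Implicit Types (G : 'rV[R]_n -> 'M[R]_n) (x : 'rV[R]_n).

(* [christoffel G x k i j] is Gamma^k_{ij} at x. *)
Definition christoffel G x (k i j : 'I_n) : R :=
  2^-1 * \sum_(l < n) invmx (G x) k l *
    (pd i (fun y => G y j l) x + pd j (fun y => G y i l) x
     - pd l (fun y => G y i j) x).

(* Sign convention: positive on round spheres. *)
Definition ricci G x : 'M[R]_n := \matrix_(i, j)
  (\sum_(k < n) pd k (fun y => christoffel G y k i j) x
   - \sum_(k < n) pd j (fun y => christoffel G y k i k) x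
   + \sum_(k < n) \sum_(l < n)
       (christoffel G x k k l * christoffel G x l i j
        - christoffel G x k j l * christoffel G x l i k)).

Definition quad (A : 'M[R]_n) (v : 'rV[R]_n) : R := (v *m A *m v^T) 0 0.

End Curvature.

Section LorentzGeometry.
Context {R : realType} {n : nat} {M : manifold R n}.
Variable g : lorentz_metric M.
Implicit Types (J : set R) (c : R -> M).

Definition einstein : Prop := exists lambda : R,
  forall (i : chart_index M) x, img i x -> ricci (g i) x = lambda *: g i x.

Definition open_interval J : Prop := [/\ open J, is_interval J & J !=set0].

(* Curves are total functions R -> M of which only the restriction to the
   parameter interval J is meaningful. *)
Definition geodesic J c : Prop :=
  [/\ open_interval J, {in J, continuous c} &
   forall (i : chart_index M) s, J s -> dom i (c s) ->
   let X := coord i \o c in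
   [/\ derivable X s 1, derivable (derive1 X) s 1 &
    forall k : 'I_n,
      derive1n 2 X s 0 k
      + \sum_(a < n) \sum_(b < n)
          christoffel (g i) (X s) k a b * derive1 X s 0 a * derive1 X s 0 b = 0]].

Definition null_velocity J c : Prop :=
  forall (i : chart_index M) s, J s -> dom i (c s) ->
  let X := coord i \o c in
  derive1 X s <> 0 /\ quad (g i (X s)) (derive1 X s) = 0.

Definition null_geodesic J c : Prop := geodesic J c /\ null_velocity J c.

Definition inextendible_null_geodesic J c : Prop :=
  null_geodesic J c /\
  forall J' c', null_geodesic J' c' -> J `<=` J' ->
    (forall s, J s -> c' s = c s) -> J' = J.

Definition incomplete_null_geodesic J c : Prop :=
  inextendible_null_geodesic J c /\ J <> [set: R].

Definition schwarzian (p : R -> R) (s : R) : R :=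
  derive1n 3 p s / derive1 p s - 3 / 2 * (derive1n 2 p s / derive1 p s) ^+ 2.

(* For n = 2 the Ricci tensor is a multiple of the metric, so Ric(c', c') = 0
   on null geodesics; since division by zero yields 0, the equation then reads
   {p, s} = 0. *)
Definition projective_parameter J c (p : R -> R) : Prop :=
  forall s, J s ->
  [/\ forall m : nat, (m < 3)%N -> derivable (derive1n m p) s 1,
      derive1 p s <> 0 &
      forall i : chart_index M, dom i (c s) ->
      let X := coord i \o c in
      schwarzian p s =
        - (2 / (n%:R - 2)) * quad (ricci (g i) (X s)) (derive1 X s)].

Definition I_disk : set R := `]-1, 1[.

Definition projectively_parametrized (gamma : R -> M) : Prop :=
  exists J c p, [/\ null_geodesic J c, projective_parameter J c p,
    p @` J = I_disk & forall s, J s -> gamma (p s) = c s].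

(* Distance of the metric 4 du^2 / (1 - u^2)^2. *)
Definition rho (u v : R) : R :=
  `| ln (((1 + u) * (1 - v)) / ((1 - u) * (1 + v))) |.

(* The points x_0, ..., x_k are [kp_point 0], ..., [kp_point k], and a_i, b_i,
   gamma_i (1 <= i <= k) are indexed here from 0; values at larger indices are
   irrelevant. *)
Record kobayashi_path (x y : M) := KobayashiPath {
  kp_size : nat;
  kp_point : nat -> M;
  kp_a : nat -> R;
  kp_b : nat -> R;
  kp_gamma : nat -> R -> M;
  kp_size_gt0 : (0 < kp_size)%N;
  kp_start : kp_point 0%N = x;
  kp_end : kp_point kp_size = y;
  kp_step : forall i : nat, (i < kp_size)%N ->
    [/\ I_disk (kp_a i) /\ I_disk (kp_b i),
        projectively_parametrized (kp_gamma i),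
        kp_gamma i (kp_a i) = kp_point i &
        kp_gamma i (kp_b i) = kp_point i.+1]
}.

Definition kp_length (x y : M) (alpha : kobayashi_path x y) : R :=
  \sum_(i < kp_size alpha) rho (kp_a alpha i) (kp_b alpha i).

(* A real infimum: on a connected Lorentz manifold of dimension >= 2 any two
   points are joined by a Kobayashi path, so the set of lengths is nonempty,
   and it is bounded below by 0. *)
Definition kobayashi_dist (x y : M) : R := inf (range (@kp_length x y)).

Definition kobayashi_nontrivial : Prop :=
  exists x y : M, kobayashi_dist x y <> 0.

Definition kobayashi_nondegenerate : Prop :=
  forall x y : M, kobayashi_dist x y = 0 -> x = y.

End LorentzGeometry.

(* Main.v *)
Require Import Defs.
From HB Require Import structures.
From mathcomp Require Import all_boot all_order all_algebra.
From mathcomp Require Import all_classical all_reals all_analysis.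

(** On an Einstein manifold [Ric(c', c')] is a multiple of [g(c', c') = 0] along
a null geodesic [c], so the projective parameters are the Moebius functions of
the affine one.  If [c] is defined on all of R, then [s |-> k s] on the
interval (-1/k, 1/k) is a projective parameter onto [I] for every [k > 0],
and [rho (k s) (k t)] tends to 0 with [k]: any two points of a complete null
geodesic are at distance 0.  Such a geodesic is not constant, which gives (2).
For (1), by Zorn's lemma each geodesic in a Kobayashi path extends to an
inextendible one; if all of these are complete, every step of the path can be
replaced by an arbitrarily short one. *)

Set Implicit Arguments.
Unset Strict Implicit.
Unset Printing Implicit Defensive.

Import Order.TTheory GRing.Theory Num.Theory.
Import numFieldNormedType.Exports.

Local Open Scope classical_set_scope.
Local Open Scope ring_scope.

(** * Linear changes of parameter and the Poincaré distance *)

Lemma near_eq_derive1 (R : realType) (V : normedModType R) (f h : R -> V)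
    (s : R) :
  {near s, f =1 h} -> {near s, derive1 f =1 derive1 h}.
Proof.
move=> /near_join; apply: filterS => t fh.
by rewrite !derive1E; apply: near_eq_derive.
Qed.

Lemma derive1_mulrl (R : realType) (k : R) :
  derive1 (fun x : R => k * x) = cst k.
Proof.
apply/funext => x; rewrite derive1E.
by rewrite deriveMl ?derive_id ?mulr1 //; exact: derivable_id.
Qed.

Lemma derive1n_mulrl (R : realType) (k : R) (m : nat) :
  derive1n m.+2 (fun x : R => k * x) = cst 0.
Proof.
by elim: m => [|m IHm]; rewrite derive1nS ?derive1n1 ?derive1_mulrl ?IHm;
  apply/funext => x; rewrite derive1_cst.
Qed.

Lemma derivable_derive1n_mulrl (R : realType) (k : R) (m : nat) (s : R) :
  derivable (derive1n m (fun x : R => k * x)) s 1.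
Proof.
case: m => [|[|m]].
- by apply: derivableM; [exact: derivable_cst|exact: derivable_id].
- by rewrite derive1n1 derive1_mulrl; exact: derivable_cst.
- by rewrite derive1n_mulrl; exact: derivable_cst.
Qed.

(** At [k = 0] the four factors of the fraction in [rho] all equal 1, so by continuity its logarithm
    tends to [ln 1 = 0]. *)
Lemma rho_scale_cvg0 (R : realType) (s t : R) :
  rho (k * s) (k * t) @[k --> (0 : R)] --> (0 : R).
Proof.
have lin (a : R) : (fun k : R => k * a) @ (0 : R) --> (0 : R).
  by rewrite -[X in _ --> X](mul0r a); apply: cvgMr_tmp; exact: cvg_id.
have addl (a : R) : (1 + k * a) @[k --> (0 : R)] --> (1 : R).
  by rewrite -[X in _ --> X]addr0; apply: cvgD; [exact: cvg_cst|exact: lin].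
have subl (a : R) : (1 - k * a) @[k --> (0 : R)] --> (1 : R).
  by rewrite -[X in _ --> X]subr0; apply: cvgB; [exact: cvg_cst|exact: lin].
have mul1 (u v : R -> R) : u @ (0 : R) --> (1 : R) -> v @ (0 : R) --> (1 : R) ->
    (u k * v k) @[k --> (0 : R)] --> (1 : R).
  by move=> u1 v1; have := cvgM u1 v1; rewrite mulr1; apply.
suff : rho (k * s) (k * t) @[k --> (0 : R)] --> `|ln (1 : R)|.
  by rewrite ln1 normr0.
apply: cvg_norm; apply: continuous_cvg; first exact: continuous_ln.
apply: (mul1); first exact: (mul1 _ _ (addl s) (subl t)).
have := cvgV (oner_neq0 R) (mul1 _ _ (subl s) (addl t)).
by rewrite invr1; apply.
Qed.

Lemma exists_scale_rho_lt (R : realType) (s t e : R) : 0 < e ->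
  exists k : R, [/\ 0 < k, `|k * s| < 1, `|k * t| < 1 &
                    rho (k * s) (k * t) < e].
Proof.
move=> e0.
(* Right neighbourhoods of 0 turn [0 < k] into an eventual property, to be combined with the three
   others. *)
have lin (a : R) : \forall k \near (0 : R)^'+, `|k * a| < 1.
  apply: cvgr0_norm_lt ltr01; apply: cvg_at_right_filter.
  by rewrite -[X in _ --> X](mul0r a); apply: cvgMr_tmp; exact: cvg_id.
have rho_lt : \forall k \near (0 : R)^'+, rho (k * s) (k * t) < e.
  by have /cvg_at_right_filter/cvgr_lt := @rho_scale_cvg0 R s t; apply.
have : \forall k \near (0 : R)^'+, [/\ 0 < k, `|k * s| < 1, `|k * t| < 1 &
                    rho (k * s) (k * t) < e].
  near=> k; split; near: k => //.
  exact: nbhs_right_gt.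
by move=> /filter_ex.
Unshelve. all: by end_near. Qed.

Section NullGeodesics.
Context {R : realType} {n : nat} {M : manifold R n} (g : lorentz_metric M).
Implicit Types (J : set R) (c : R -> M).

(** * Local nature of null geodesics *)

(** The conditions at [s] involve only the germ of the curve there: curves equal near [s] have the
    same first two derivatives in a chart. This serves both to restrict and to glue geodesics. *)
Lemma null_geodesic_local J c : open_interval J ->
  (forall s, J s -> exists J' c',
     [/\ null_geodesic g J' c', J' s & {near s, c' =1 c}]) ->
  null_geodesic g J c.
Proof.
move=> JI loc; split; first split => //.
- move=> s /set_mem /loc[J' [c' [[[_ c'C _] _] J's E]]].
  have c'c : c' s = c s by exact: nbhs_singleton E.
  rewrite /continuous_at -c'c.
  apply: cvg_trans (c'C s (mem_set J's)).
  by apply: near_eq_cvg.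
- move=> i s /loc[J' [c' [[[_ _ c'G] _] J's E]]].
  have c'c : c' s = c s by exact: nbhs_singleton E.
  rewrite -c'c => cs_dom; have [/= d1 d2 geo] := c'G i s J's cs_dom.
  have E0 : {near s, Defs.coord i \o c' =1 Defs.coord i \o c}.
    by apply: filterS E => t /= ->.
  have E1 := near_eq_derive1 E0.
  have E2 := near_eq_derive1 E1.
  split; [exact: near_eq_derivable E0 d1|exact: near_eq_derivable E1 d2|].
  move=> k; have := geo k; rewrite /= c'c.
  by rewrite (nbhs_singleton E1) (nbhs_singleton E2).
- move=> i s /loc[J' [c' [[_ c'N] J's E]]].
  have c'c : c' s = c s by exact: nbhs_singleton E.
  rewrite -c'c => cs_dom; have := c'N i s J's cs_dom.
  have E0 : {near s, Defs.coord i \o c' =1 Defs.coord i \o c}.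
    by apply: filterS E => t /= ->.
  by rewrite /= c'c (nbhs_singleton (near_eq_derive1 E0)).
Qed.

Lemma null_geodesic_restrict J J' c : open_interval J -> J `<=` J' ->
  null_geodesic g J' c -> null_geodesic g J c.
Proof.
move=> JI JJ' cJ'; apply: null_geodesic_local => // s /JJ' J's.
exists J', c; split => //; exact: (filterS _ filterT).
Qed.

(** A constant curve has zero velocity in any chart around [p], while a null velocity is nonzero. *)
Lemma null_geodesic_not_const J c (p : M) : null_geodesic g J c ->
  ~ (forall s, J s -> c s = p).
Proof.
move=> [[[oJ _ [s Js]] _ _] cN] cp.
have [i ip] := @atlas_cover _ _ M p.
have [|/= + _] := cN i s Js; first by rewrite cp.
apply; have E : {near s, Defs.coord i \o c =1 cst (Defs.coord i p)}.
  have := open_nbhs_nbhs (conj oJ Js).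
  by apply: filterS => t Jt /=; rewrite cp.
by rewrite (nbhs_singleton (near_eq_derive1 E)) derive1_cst.
Qed.

(** * Inextendible extensions by Zorn's lemma *)

(** Only a preorder: values outside the intervals are arbitrary, so antisymmetry fails. *)
Definition curve_extends (a b : set R * (R -> M)) : Prop :=
  a.1 `<=` b.1 /\ forall s, a.1 s -> b.2 s = a.2 s.

(** The upper bound for Zorn's lemma: members of a chain agree on overlaps, so they glue to a curve
    on the union of their intervals. *)
Lemma chain_null_geodesic (A : set (set R * (R -> M))) : A !=set0 ->
  total_on A curve_extends -> (forall a, A a -> null_geodesic g a.1 a.2) ->
  exists2 b, null_geodesic g b.1 b.2 & forall a, A a -> curve_extends a b.
Proof.
move=> [a0 Aa0] Atot Ageo.
(* [f s] is a member of the chain defined at [s]; off the union it is the dummy [a0]. *)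
have [f fP] : {f : R -> set R * (R -> M) &
    forall s, (exists2 a, A a & a.1 s) -> A (f s) /\ (f s).1 s}.
  apply: (@choice _ _
    (fun s a => (exists2 a, A a & a.1 s) -> A a /\ a.1 s)) => s.
  have [[a Aa as_]|nA] := pselect (exists2 a, A a & a.1 s).
    by exists a.
  by exists a0.
have agree a b s : A a -> A b -> a.1 s -> b.1 s -> a.2 s = b.2 s.
  by move=> Aa Ab as_ bs; have [[_ ->]|[_ ->]] := Atot a b Aa Ab.
pose U := [set s | exists2 a, A a & a.1 s].
pose c s := (f s).2 s.
have cE a s : A a -> a.1 s -> c s = a.2 s.
  move=> Aa as_; have [Af fs] := fP s (ex_intro2 _ _ a Aa as_).
  exact: agree.
exists (U, c) => /=; last first.
  by move=> a Aa; split => [s as_|s]; [exists a|exact: cE].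
apply: null_geodesic_local => [|s [a Aa as_]].
  split.
  - rewrite openE => s [a Aa as_].
    have [[[oa _ _] _ _] _] := Ageo a Aa.
    have := open_nbhs_nbhs (conj oa as_); apply: filterS => t at_.
    by exists a.
  (* The larger of the two intervals contains both [x] and [y], hence all that lies between. *)
  - move=> x y [a Aa ax] [b Ab by_] z xzy.
    have [[[_ ia _] _ _] _] := Ageo a Aa.
    have [[[_ ib _] _ _] _] := Ageo b Ab.
    have [[ab _]|[ba _]] := Atot a b Aa Ab.
      by exists b => //; apply: (ib x y) => //; exact: ab.
    by exists a => //; apply: (ia x y) => //; exact: ba.
  - by have [[[_ _ [s as_]] _ _] _] := Ageo a0 Aa0; exists s, a0.
exists a.1, a.2; split => //; first exact: Ageo.
have [[[oa _ _] _ _] _] := Ageo a Aa.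
by have := open_nbhs_nbhs (conj oa as_); apply: filterS => t at_;
  rewrite (cE a).
Qed.

Lemma inextendible_extension J c : null_geodesic g J c ->
  exists J' c', [/\ inextendible_null_geodesic g J' c', J `<=` J' &
                    forall s, J s -> c' s = c s].
Proof.
move=> cJ.
(* Only extensions of [(J, c)] are ordered, so that a maximal one still extends [c]. *)
pose T := {a : set R * (R -> M) |
  null_geodesic g a.1 a.2 /\ curve_extends (J, c) a}.
pose ext (a b : T) := `[< curve_extends (sval a) (sval b) >].
have extT : forall a b d, curve_extends a b -> curve_extends b d ->
    curve_extends a d.
  move=> a b d [ab abE] [bd bdE]; split; first exact: subset_trans ab bd.
  by move=> s as_; rewrite bdE ?abE //; exact: ab.
have t0 : T by exists (J, c); split => //; split.
have [||A Atot|[[J' c'] [/= c'J' [JJ' cc']]] mx] := @ZL_preorder T t0 ext.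
- by move=> a; apply/asboolP; split.
- move=> a b d /asboolP ba /asboolP bd; apply/asboolP; exact: extT ba bd.
(* The empty chain is bounded by [(J, c)] itself. *)
- have [[a Aa]|A0] := pselect (A !=set0); last first.
    by exists t0 => a Aa; exfalso; apply: A0; exists a.
  have [|||b bG bext] :=
      @chain_null_geodesic [set sval a | a in A].
  + by exists (sval a), a.
  + move=> _ _ [x Ax <-] [y Ay <-].
    by case: (Atot x y Ax Ay) => /asboolP; [left|right].
  + by move=> _ [x _ <-]; case: (svalP x).
  have Jb : curve_extends (J, c) b.
    by apply: (extT _ (sval a)); [case: (svalP a)|apply: bext; exists a].
  exists (exist _ b (conj bG Jb)) => s As; apply/asboolP => /=.
  by apply: bext; exists s.
exists J', c'; split => //; split => // J2 c2 c2J2 J'J2 c2c'.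
have e2 : curve_extends (J', c') (J2, c2) by [].
have JJ2 : curve_extends (J, c) (J2, c2).
  by apply: extT e2; split.
have := mx (exist _ (J2, c2) (conj c2J2 JJ2)).
move=> /(_ (asboolT e2)) /asboolP[/= J2J' _].
by apply/seteqP.
Qed.

(** * Projective parameters in the Einstein case *)

Lemma einstein_ricci_null J c i s : einstein g -> null_geodesic g J c ->
  J s -> dom i (c s) -> let X := Defs.coord i \o c in
  quad (ricci (g i) (X s)) (derive1 X s) = 0.
Proof.
move=> [lambda gE] [_ cN] Js cs_dom X; have [/= _] := cN i s Js cs_dom.
rewrite gE /quad; last by exists (c s).
by move=> q0; rewrite -scalemxAr -scalemxAl mxE q0 mulr0.
Qed.

Lemma complete_projectively_parametrized c (k : R) : einstein g ->
  null_geodesic g setT c -> 0 < k ->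
  projectively_parametrized g (fun u => c (k^-1 * u)).
Proof.
move=> gE cG k0; have kN0 := lt0r_neq0 k0.
have ki0 : 0 < k^-1 by rewrite invr_gt0.
have JI : open_interval `](- k^-1), k^-1[%classic.
  split; [exact: interval_open|exact: interval_is_interval|].
  by exists 0; rewrite /= in_itv /= oppr_lt0 ki0.
exists `](- k^-1), k^-1[%classic, c, (fun s => k * s); split.
- exact: null_geodesic_restrict cG.
- move=> s _; split.
  + by move=> m _; exact: derivable_derive1n_mulrl.
  + by rewrite derive1_mulrl; exact/eqP.
  (* The Ricci term vanishes, so the right-hand side is 0 whatever its coefficient, also for
     [n = 2]. On the left, the second and third derivatives of a linear function are 0. *)
  + move=> i cs_dom X; rewrite (einstein_ricci_null gE cG) // mulr0.
    by rewrite /schwarzian !derive1n_mulrl /= mul0r expr0n /= mulr0 subrr.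
- apply/seteqP; split => [_ [s /= + <-]|u]; rewrite /I_disk /= !in_itv /=.
    rewrite -[k^-1]mulr1 -mulrN => /andP[].
    by rewrite ltr_pdivrMl // ltr_pdivlMl // => -> ->.
  move=> /andP[u1 u2]; exists (k^-1 * u); last by rewrite mulVKf.
  rewrite /= in_itv /= -[X in - X]mulr1 -[X in _ && (_ < X)]mulr1 -mulrN.
  by rewrite !ltr_pM2l // u1.
- by move=> s _; rewrite mulKf.
Qed.

(** * Vanishing of the Kobayashi pseudodistance *)

Lemma kobayashi_dist_eq0 (x y : M) :
  (forall e, 0 < e -> exists alpha : kobayashi_path g x y,
     kp_length alpha < e) ->
  kobayashi_dist g x y = 0.
Proof.
move=> small; pose S := range (@kp_length _ _ _ g x y).
have lb0 : lbound S 0.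
  by move=> _ [alpha _ <-]; apply: sumr_ge0 => i _; exact: normr_ge0.
apply/eqP; rewrite eq_le; apply/andP; split; last first.
  (* Any one path, here of length below 1, shows that the set of lengths is nonempty. *)
  apply: lb_le_inf lb0; have [alpha _] := small 1 ltr01.
  by exists (kp_length alpha), alpha.
apply/ler_addgt0Pl => e e0; rewrite addr0.
have [alpha /ltW] := small e e0; apply: le_trans.
by apply: ge_inf; [exists 0|exists alpha].
Qed.

(** The endpoints stay fixed while rescaling moves their parameters to [k * s] and [k * t], as close
    as desired for small [k]. *)
Lemma complete_short_step c (s t e : R) : einstein g ->
  null_geodesic g setT c -> 0 < e ->
  exists a b gamma, [/\ I_disk a /\ I_disk b,
    projectively_parametrized g gamma, gamma a = c s, gamma b = c t &
    rho a b < e].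
Proof.
move=> gE cG e0; have [k [k0 ks kt rk]] := @exists_scale_rho_lt R s t e e0.
exists (k * s), (k * t), (fun u => c (k^-1 * u)).
have kN0 := lt0r_neq0 k0.
split => //; last 2 first.
- by rewrite mulKf.
- by rewrite mulKf.
- by rewrite /I_disk /= !in_itv /= -!ltr_norml.
- exact: complete_projectively_parametrized.
Qed.

Lemma complete_kobayashi_dist_eq0 c (s t : R) : einstein g ->
  null_geodesic g setT c -> kobayashi_dist g (c s) (c t) = 0.
Proof.
move=> gE cG; apply: kobayashi_dist_eq0 => e e0.
have [a [b [gamma [ab pp ga gb rab]]]] := complete_short_step s t gE cG e0.
have step i : (i < 1)%N -> [/\ I_disk a /\ I_disk b,
    projectively_parametrized g gamma,
    gamma a = (if i == 0 then c s else c t) &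
    gamma b = (if i.+1 == 0 then c s else c t)].
  by case: i.
exists (@KobayashiPath _ _ _ g (c s) (c t) 1
  (fun i => if i == 0 then c s else c t) (fun=> a) (fun=> b) (fun=> gamma)
  isT erefl erefl step).
by rewrite /kp_length /= big_ord1.
Qed.

Lemma all_complete_kobayashi_dist_eq0 (x y : M) : einstein g ->
  (forall J c, inextendible_null_geodesic g J c -> J = setT) ->
  kobayashi_dist g x y = 0.
Proof.
move=> gE compl.
have [[alpha0]|noalpha] :=
  pselect (inhabited (kobayashi_path g x y)); last first.
  (* The infimum of the empty set is 0. *)
  rewrite /kobayashi_dist (_ : range _ = set0) ?inf0 //.
  by apply/seteqP; split => // z [alpha]; case: noalpha.
apply: kobayashi_dist_eq0 => e e0.
set m := kp_size alpha0.
have m0 : 0 < m%:R :> R by rewrite ltr0n; exact: kp_size_gt0.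
(* The triple [q] holds new data [a], [b], [gamma] for step [i]; each of the [m] steps may cost at
   most [e / m]. *)
have short i : exists q : R * R * (R -> M), (i < m)%N ->
  [/\ I_disk q.1.1 /\ I_disk q.1.2, projectively_parametrized g q.2,
      q.2 q.1.1 = kp_point alpha0 i, q.2 q.1.2 = kp_point alpha0 i.+1 &
      rho q.1.1 q.1.2 < e / m%:R].
  case: (ltnP i m) => [im|_]; last by exists (0, 0, fun=> x).
  have [[Ia Ib] [J [c [p [cG _ pJ pE]]]] <- <-] := kp_step im.
  have [J' [c' [c'G JJ' cc']]] := inextendible_extension cG.
  have J'T := compl _ _ c'G; rewrite J'T in c'G.
  (* Since [p] maps [J] onto [I], the endpoints of the step are [c s] and [c t] for affine
     parameters [s], [t], and so lie on the complete extension [c']. *)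
  have : (p @` J) (kp_a alpha0 i) by rewrite pJ.
  have : (p @` J) (kp_b alpha0 i) by rewrite pJ.
  move=> [t Jt <-] [s Js <-]; rewrite !pE // -!cc' //.
  have [|a [b [gamma P]]] :=
    complete_short_step s t gE (proj1 c'G) (e := e / m%:R).
    by rewrite divr_gt0.
  by exists (a, b, gamma).
have [f fP] := choice short.
have step i : (i < m)%N -> [/\ I_disk (f i).1.1 /\ I_disk (f i).1.2,
    projectively_parametrized g (f i).2,
    (f i).2 (f i).1.1 = kp_point alpha0 i &
    (f i).2 (f i).1.2 = kp_point alpha0 i.+1].
  by move=> /fP[].
exists (@KobayashiPath _ _ _ g x y m (kp_point alpha0) (fun i => (f i).1.1)
  (fun i => (f i).1.2) (fun i => (f i).2) (kp_size_gt0 alpha0)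
  (kp_start alpha0) (kp_end alpha0) step).
have -> : e = \sum_(i < m) (e / m%:R).
  by rewrite sumr_const card_ord -[RHS]mulr_natr divfK // gt_eqF.
(* Strictness of the summed inequality requires at least one step, whence the index 0 below. *)
apply: ltr_sum => [|i _].
  by apply/hasP; exists (Ordinal (kp_size_gt0 alpha0)); rewrite ?mem_index_enum.
by have [] := fP i (ltn_ord i).
Qed.

End NullGeodesics.

Theorem mainTheorem1 (R : realType) (n : nat) (n_ge2 : (2 <= n)%N)
    (M : manifold R n) (M_connected : connected [set: M])
    (g : lorentz_metric M) (g_einstein : einstein g) :
  (kobayashi_nontrivial g ->
     exists (J : set R) (c : R -> M), incomplete_null_geodesic g J c) /\
  (kobayashi_nondegenerate g ->
     forall (J : set R) (c : R -> M),
       inextendible_null_geodesic g J c -> incomplete_null_geodesic g J c).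
Proof.
split=> [[x [y dxy]]|nondeg J c cJ].
  apply: contrapT => noinc; apply: dxy.
  apply: all_complete_kobayashi_dist_eq0 => // J c cJ.
  by apply: contrapT => JN; apply: noinc; exists J, c.
split=> // JT; have [cG _] := cJ; rewrite JT in cG.
(* Zero distance from [c 0] to every [c s] would make [c] constant. *)
apply: (null_geodesic_not_const cG (p := c 0)) => s _.
by apply: nondeg; apply: complete_kobayashi_dist_eq0.
Qed.
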